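(* For every $t\ge0$, every $\alpha\ge1$ and every $f\in F_0(G)$, the interacting particle system started from $f$ satisfies $\mathbb E_f\|f_t\|_\alpha^\alpha<\infty$.
   Context: A graph is a quadruple $G=(V,E,K,m)$: $V$ is a finite or countable set of nodes, which are elements of a real Hilbert space $\mathcal H$ with inner product ''$\cdot$'' and norm $|\cdot|$; $E$ is a set of undirected edges (at most one edge between any two distinct nodes, no self-loops); the edge between $x$ and $y$ is written $\langle x,y\rangle=\langle y,x\rangle$, and $y\sim x$ means this edge exists; $K=(k_{xy})_{x,y\in V}$ with $k_{xy}=k_{yx}\ge0$ and $k_{xy}=0$ if there is no edge; $m=(m_x)_{x\in V}$ with $m_x>0$. Let $e_{xy}=(y-x)/|y-x|$. Assume $d_0=\sup_{x\in V}\#\{y:y\sim x\}<\infty$, set $d=\max\{d_0,2\}$, and assume $M=\max\{\sup_{x\in V}m_x^{-1},\sup_{\langle x,y\rangle\in E}k_{xy}\}<\infty$. $V=V_0\cup V_1$ is a fixed partition into disjoint sets. $F(G)$ is the set of functions $f$ assigning a real number $f(x)$ to each $x\in V$ and a vector $f(\langle x,y\rangle)\in\mathcal H$ that is a real multiple of $y-x$ to each edge. For $1\le\alpha<\infty$, $\|f\|_\alpha=\big(\sum_{x\in V}|f(x)|^\alpha/m_x+\sum_{\langle x,y\rangle\in E}k_{xy}|f(\langle x,y\rangle)|^\alpha\big)^{1/\alpha}$, and $\|f\|_\infty=\max\{\sup_x|f(x)|,\sup_{\langle x,y\rangle}|f(\langle x,y\rangle)|\}$. $F_0(G)$ is the set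 of $f\in F(G)$ with finitely many nonzero values such that $|f(x)|\in\mathbb Z$ and $|f(\langle x,y\rangle)|\in\mathbb Z$ for all nodes and edges. The interacting particle system (IPS) $(f_t)_{t\ge0}$ is the continuous-time Markov jump process on $F_0(G)$ with the following transitions from state $f$: (i) for each $x\in V$, at rate $|f(x)|/m_x$, for every $y\sim x$ the edge value $f(\langle x,y\rangle)$ is replaced by $f(\langle x,y\rangle)+\mathrm{sgn}(f(x))\,e_{yx}$ (all other values unchanged); (ii) for each edge $\langle x,y\rangle$, at rate $k_{xy}|f(\langle x,y\rangle)|$, with $s=\mathrm{sgn}(f(\langle x,y\rangle)\cdot e_{xy})$, the value $f(x)$ is replaced by $f(x)+s$ if $x\in V_0$ and $f(y)$ by $f(y)-s$ if $y\in V_0$ (values at nodes of $V_1$ never change; this rule is symmetric in $x,y$). $P_f,\mathbb E_f$ denote probability and expectation given $f_0=f$. $\tau_0=0$, $\tau_n$ is the time of the $n$-th jump, $\xi_n=\tau_n-\tau_{n-1}$, $h_n=f_{\tau_n}$, and $\eta_t=\sup\{n:\tau_n\le t\}$. *)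

(* Defs.v *)
From HB Require Import structures.
From mathcomp Require Import all_boot all_order all_algebra.
From mathcomp Require Import all_classical all_reals all_analysis.
From mathcomp Require Import measurable_realfun lebesgue_integral.
Set Implicit Arguments. Unset Strict Implicit. Unset Printing Implicit Defensive.
Import Order.TTheory GRing.Theory Num.Theory.
Local Open Scope classical_set_scope.
Local Open Scope ring_scope.

(* Graph encoding:
   - V : countType  = nodes;  E : countType = (undirected) edges, each edge e
     is given with a fixed (arbitrary) orientation  <src e, dst e>.
   - A state f in F(G) is a pair  (node values : V -> int, edge coefficients : E -> int)
     where the vector edge value is  f(<src e,dst e>) = (f.2 e) * e_{src e, dst e};
     this is a bijective encoding of "a real multiple of y-x of integer norm",
     and |f(<x,y>)| = |f.2 e|,  sgn(f(<x,y>) . e_{xy}) = sgz (f.2 e) for x = src e. *)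

Definition state (V E : Type) := ((V -> int) * (E -> int))%type.

(* F_0(G): finitely many nonzero values (integrality is built into the type) *)
Definition F0 (V E : Type) (g : state V E) : Prop :=
  finite_set [set x | g.1 x != 0] /\ finite_set [set e | g.2 e != 0].

Section Moves.
Context (V E : countType) (src dst : E -> V) (V0 : set V).

(* transition (i) at node x: for every y ~ x,
   f(<x,y>) <- f(<x,y>) + sgn(f(x)) e_{yx} *)
Definition node_move (x : V) (g : state V E) : state V E :=
  (g.1, fun e => g.2 e - sgz (g.1 x) * ((src e == x) : int)
                       + sgz (g.1 x) * ((dst e == x) : int)).

(* transition (ii) at edge e = <x,y>, x = src e, y = dst e:
   s = sgn(f(<x,y>) . e_{xy});  f(x) <- f(x)+s if x in V0;  f(y) <- f(y)-s if y in V0 *)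
Definition edge_move (e : E) (g : state V E) : state V E :=
  (fun z => g.1 z + sgz (g.2 e) * (((z == src e) && (z \in V0)) : int)
                  - sgz (g.2 e) * (((z == dst e) && (z \in V0)) : int),
   g.2).
End Moves.

Section Rates.
Context {R : realType} (V E : countType) (src dst : E -> V) (V0 : set V)
        (m : V -> R) (k : E -> R).

(* Q-matrix entry q(g,g') for g' <> g: total rate of the transitions leading from g to g' *)
Definition ips_rate (g g' : state V E) : R :=
  (\sum_(x \in [set x | node_move src dst x g = g']) (`|g.1 x|%:~R / m x))%R
  + (\sum_(e \in [set e | edge_move src dst V0 e g = g']) (k e * `|g.2 e|%:~R))%R.

(* total jump rate q(g) = sum over g' <> g of q(g,g') *)
Definition ips_qtot (g : state V E) : R :=
  (\sum_(x \in [set x | node_move src dst x g <> g]) (`|g.1 x|%:~R / m x))%R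
  + (\sum_(e \in [set e | edge_move src dst V0 e g <> g]) (k e * `|g.2 e|%:~R))%R.

Definition ips_jump (g g' : state V E) : R :=
  if ips_qtot g == 0 then (`[< g' = g >])%:R
  else if `[< g' = g >] then 0 else ips_rate g g' / ips_qtot g.

Definition ips_normp (alpha : R) (g : state V E) : R :=
  (\sum_(x \in [set: V]) ((`|g.1 x|%:~R `^ alpha) / m x))%R
  + (\sum_(e \in [set: E]) (k e * (`|g.2 e|%:~R `^ alpha)))%R.
End Rates.

Definition jump_time {R : realType} (Omega : Type) (xi : nat -> Omega -> \bar R)
  (n : nat) (w : Omega) : \bar R :=
  (\sum_(1 <= i < n.+1) xi i w)%E.

(* the value of the observable g |-> ||g||_alpha^alpha at f_t = h_{eta_t},
   eta_t = sup {n | tau_n <= t};  +oo if eta_t = +oo (explosion before t) *)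
Definition ips_normp_at {R : realType} (V E : countType) (Omega : Type)
  (h : nat -> Omega -> state V E) (xi : nat -> Omega -> \bar R)
  (normp : state V E -> R) (t : R) (w : Omega) : \bar R :=
  match pselect (exists n : nat, (jump_time xi n w <= t%:E)%E /\
                  forall n', (jump_time xi n' w <= t%:E)%E -> (n' <= n)%N) with
  | left H => (normp (h (proj1_sig (cid H)) w))%:E
  | right _ => +oo%E
  end.

(* (h_n, xi_n) is the jump chain / holding times of the IPS started at f:
   for all n, g_0..g_n, s_1..s_n >= 0,
   P(h_i = g_i (i <= n), xi_i > s_i (1 <= i <= n))
     = [g_0 = f] prod_{i=1}^n pi(g_{i-1},g_i) exp(-q(g_{i-1}) s_i). *)
Definition is_IPS {R : realType} (V E : countType) (src dst : E -> V) (V0 : set V)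
  (m : V -> R) (k : E -> R) (d : measure_display) (Omega : measurableType d)
  (P : probability Omega R) (f : state V E)
  (h : nat -> Omega -> state V E) (xi : nat -> Omega -> \bar R) : Prop :=
  (forall n g, measurable [set w | h n w = g]) /\
  (forall n, measurable_fun setT (xi n)) /\
  (forall (n : nat) (g : nat -> state V E) (s : nat -> R),
     (forall i, 0 <= s i) ->
     P [set w | (forall i, (i <= n)%N -> h i w = g i) /\
                (forall i, (1 <= i <= n)%N -> ((s i)%:E < xi i w)%E)]
     = ((`[< g 0%N = f >])%:R *
        \prod_(1 <= i < n.+1)
           (ips_jump src dst V0 m k (g i.-1) (g i)
            * expR (- ips_qtot src dst V0 m k (g i.-1) * s i)))%:E).

(* Main.v *)
Require Import Defs.
From HB Require Import structures.
From mathcomp Require Import all_boot all_order all_algebra.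
From mathcomp Require Import all_classical all_reals all_analysis.
From mathcomp Require Import measurable_realfun lebesgue_integral.
From mathcomp Require Import zify ring lra.
Import Order.TTheory GRing.Theory Num.Theory HBNNSimple.
Local Open Scope classical_set_scope.
Local Open Scope ring_scope.

Set Implicit Arguments.
Unset Strict Implicit.
Unset Printing Implicit Defensive.

(** Let [S] be the sum of the absolute values of all node and edge values. One
    jump increases [S] by at most a constant, so after [n] jumps [S], hence the
    total jump rate, is at most linear in [n], and [||.||_alpha^alpha] is at
    most polynomial in [n]. It remains to see that the number of jumps before
    time [t] has all moments. Say that the rate after [n] jumps is at most
    [L (n + 1)]. By a Chernoff bound, [P (tau_n <= t)] is at most
    [expR (theta t)] times a product of one factor per jump, bounding the mean
    of [expR (- theta xi)] along every path of the jump chain. For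
    [theta = L r e] the factors telescope to [(r e / (n + r e)) ^ r], so that
    [P (tau_n <= t) = O (n ^ - r)] for every [r]. The exponentials are replaced
    by two-valued functions above them: the mean of these along a path only
    involves the probabilities of the events [h_i = g_i, xi_i > s_i] that define
    the process, and no densities. *)

Lemma Bernoulli_sub {R : realDomainType} (x : R) n : 0 <= x <= 1 ->
  1 - n%:R * x <= (1 - x) ^+ n.
Proof.
move=> /andP[x0 x1]; elim: n => [|n IH]; first by rewrite mul0r subr0 expr0.
rewrite exprS; apply: (@le_trans _ _ ((1 - x) * (1 - n%:R * x))).
  by rewrite -natr1; have := ler0n R n; nra.
by apply: ler_wpM2l; rewrite ?subr_ge0.
Qed.

Lemma prod_shifted_ratio {R : realFieldType} (a : R) n : 0 < a ->
  \prod_(i < n) ((i%:R + a) / (i.+1%:R + a)) = a / (n%:R + a).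
Proof.
move=> a_gt0; elim: n => [|n IH]; first by rewrite big_ord0 add0r divff ?gt_eqF.
by rewrite big_ord_recr/= IH mulrA mulfVK// gt_eqF// ltr_wpDl.
Qed.

Lemma inv_sqr_le_telescope {R : realFieldType} n :
  n.+1%:R ^- 2 <= 2 / n.+1%:R - 2 / n.+2%:R :> R.
Proof.
rewrite -(natr1 n.+1); have : 1 <= n.+1%:R :> R by rewrite ler1n.
move: (n.+1%:R) => x x1; have x_gt0 : 0 < x by lra.
have -> : 2 / x - 2 / (x + 1) = x^-1 * (2 / (x + 1)).
  by field; apply/andP; split; apply/eqP; lra.
rewrite expr2 invfM ler_pM2l ?invr_gt0// ler_pdivlMr ?addr_gt0//.
by rewrite mulrDr mulVf ?gt_eqF// mulr1; have := invf_le1 x_gt0; lra.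
Qed.

Lemma nneseries_inv_sqr_lty {R : realType} :
  (\sum_(0 <= n <oo) (n.+1%:R ^- 2)%:E < +oo :> \bar R)%E.
Proof.
apply: (@le_lt_trans _ _ (2%:E)); last exact: ltry.
apply: lime_le; first by apply: is_cvg_nneseries => n _ _; rewrite lee_fin.
apply: nearW => n; rewrite sumEFin lee_fin.
apply: (@le_trans _ _ (\sum_(0 <= i < n) (2 / i.+1%:R - 2 / i.+2%:R))).
  by apply: ler_sum => i _; exact: inv_sqr_le_telescope.
rewrite (telescope_sumr_eq (fun i => - (2 / i.+1%:R)))// => [|i _].
  by rewrite opprK divr1 addrC gerBl divr_ge0.
by rewrite opprK addrC.
Qed.

Lemma powR_natr_le_exp {R : realType} (a : R) n p : 0 < a <= p%:R ->
  n%:R `^ a <= n%:R ^+ p :> R.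
Proof.
move=> /andP[a_gt0 ap]; case: n => [|n].
  by rewrite powR0 ?gt_eqF// exprn_ge0.
by rewrite -powR_mulrn// ler_powR// ler1n.
Qed.

Lemma one_sub_expRN_ge {R : realType} (x : R) : 0 <= x ->
  x / (1 + x) <= 1 - expR (- x).
Proof.
move=> x_ge0; have x1_gt0 : 0 < 1 + x by rewrite ltr_wpDr.
suff : expR (- x) <= 1 / (1 + x).
  by rewrite [x / _](_ : _ = 1 - 1 / (1 + x)); [lra|field; rewrite gt_eqF].
by rewrite expRN div1r lef_pV2 ?posrE ?expR_gt0//; exact: expR_ge1Dx.
Qed.

(* The left-hand side is the mean of the step function of the Chernoff bound
   below, for an exponential variable with tail [c] at the threshold. *)
Lemma chernoff_factor_le {R : realType} (y c : R) r :
  1 <= y -> expR (- 1) <= c ->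
  1 - (1 - expR (- (r%:R * expR 1 / y))) * c <=
  ((y - 1 + r%:R * expR 1) / (y + r%:R * expR 1)) ^+ r.
Proof.
move=> y1 c_ge; set k := r%:R * expR 1.
have k_ge0 : 0 <= k by rewrite mulr_ge0// expR_ge0.
have kE : k * expR (- 1) = r%:R by rewrite -mulrA -expRD subrr expR0 mulr1.
have y_gt0 : 0 < y by lra.
have ky_ge0 : 0 <= k / y by rewrite divr_ge0// ltW.
have yk_gt0 : 0 < y + k by lra.
rewrite (_ : (y - 1 + k) / (y + k) = 1 - (y + k)^-1); last first.
  by field; rewrite gt_eqF.
apply: le_trans (Bernoulli_sub _ _); last first.
  by rewrite invr_ge0 ltW//= invf_le1//; lra.
rewrite lerD2l lerN2; apply: le_trans (_ : k / (y + k) * expR (- 1) <= _).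
  by rewrite mulrAC kE.
apply: ler_pM => //; rewrite ?divr_ge0 ?expR_ge0 ?(ltW yk_gt0)//.
apply: le_trans (one_sub_expRN_ge ky_ge0).
by rewrite le_eqVlt; apply/orP; left; apply/eqP; field; rewrite !gt_eqF.
Qed.

Lemma integral_sum_indic {d} {T : measurableType d} {R : realType}
    (mu : {finite_measure set T -> \bar R}) (I : finType) (c : I -> R)
    (A : I -> set T) : (forall i, measurable (A i)) ->
  (\int[mu]_x (\sum_i c i * \1_(A i) x)%:E = \sum_i (c i)%:E * mu (A i))%E.
Proof.
move=> mA; have int_ind i : mu.-integrable setT (EFin \o \1_(A i)).
  exact: integrable_indic.
under eq_integral do rewrite -sumEFin.
rewrite integral_sum//; last first.
  by move=> i; apply: (integrableZl measurableT (c i) (int_ind i)).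
apply: eq_bigr => i _; under eq_integral do rewrite EFinM.
by rewrite (integralZl measurableT (int_ind i)) integral_indic// setIT.
Qed.

Lemma le_integral_off_negligible {d} {T : measurableType d} {R : realType}
    (mu : {measure set T -> \bar R}) (N : set T) (u v : T -> \bar R) :
  mu.-negligible N -> (forall x, 0 <= u x)%E -> (forall x, 0 <= v x)%E ->
  measurable_fun setT v -> (forall x, ~ N x -> u x <= v x)%E ->
  (\int[mu]_x u x <= \int[mu]_x v x)%E.
Proof.
move=> negN u0 v0 mv uv; rewrite [leLHS]ge0_integralTE//.
apply: ge_ereal_sup => _ [g gu <-]; rewrite -integralT_nnsfun.
apply: ae_ge0_le_integral => //.
- by move=> x _; rewrite lee_fin; exact: fun_ge0.
- by apply/measurable_EFinP; exact: measurable_funPT.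
apply: negligibleS negN => x /= gv; apply: contrapT => Nx; apply: gv => _.
exact: le_trans (gu x) (uv x Nx).
Qed.

Section JumpPaths.
Context {R : numDomainType} {T : eqType} (x0 : T) (pi : T -> T -> R).
Context (succ : T -> seq T).

(* A path lists the states after the successive jumps; the initial state [x0]
   is not part of it. *)
Fixpoint jump_paths n : seq (seq T) :=
  if n is n'.+1
  then [seq rcons p y | p <- jump_paths n', y <- succ (last x0 p)]
  else [:: [::]].

Lemma size_jump_paths n p : p \in jump_paths n -> size p = n.
Proof.
elim: n p => [|n IH] p /=; first by rewrite inE => /eqP ->.
by move=> /allpairsPdep[p' [y [p'n _ ->]]]; rewrite size_rcons IH.
Qed.

Definition reachable n : seq T := [seq last x0 p | p <- jump_paths n].

Lemma reachable_ind (A : nat -> set T) :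
  A 0%N x0 -> (forall n x y, A n x -> y \in succ x -> A n.+1 y) ->
  forall n x, x \in reachable n -> A n x.
Proof.
move=> A0 AS n x /mapP[p]; elim: n x p => [|n IH] x p /=.
  by rewrite inE => /eqP -> ->.
move=> /allpairsPdep[p' [y [p'n yp' ->]]] ->.
by rewrite last_rcons; apply: AS yp'; exact: IH p'n _.
Qed.

Lemma jump_paths_uniq n : (forall x, uniq (succ x)) -> uniq (jump_paths n).
Proof.
move=> uniq_succ; elim: n => [|n IH] //=.
by apply: allpairs_uniq_dep => // -[p y] [p' y'] _ _ /= /rcons_inj[-> ->].
Qed.

Definition path_weight (v : nat -> T -> R) (p : seq T) : R :=
  \prod_(i < size p) (pi (nth x0 (x0 :: p) i) (nth x0 p i) *
                      v i (nth x0 (x0 :: p) i)).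

Lemma path_weight_rcons v p y : path_weight v (rcons p y) =
  path_weight v p * (pi (last x0 p) y * v (size p) (last x0 p)).
Proof.
rewrite /path_weight size_rcons big_ord_recr/= nth_rcons ltnn eqxx.
rewrite -rcons_cons nth_rcons /= ltnSn -last_nth; congr (_ * _).
by apply: eq_bigr => i _; rewrite -rcons_cons !nth_rcons (ltn_ord i) leqW.
Qed.

Hypothesis sum_pi : forall n x, x \in reachable n ->
  \sum_(y <- succ x) pi x y = 1.

Lemma sum_path_weightS v n : \sum_(p <- jump_paths n.+1) path_weight v p =
  \sum_(p <- jump_paths n) path_weight v p * v n (last x0 p).
Proof.
rewrite big_allpairs_dep big_seq [RHS]big_seq; apply: eq_bigr => p pn.
under eq_bigr do rewrite path_weight_rcons (size_jump_paths pn).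
by rewrite -mulr_sumr -mulr_suml (sum_pi (map_f _ pn)) mul1r.
Qed.

Lemma sum_path_weight1 n :
  \sum_(p <- jump_paths n) path_weight (fun _ _ => 1) p = 1.
Proof.
elim: n => [|n IH]; first by rewrite big_seq1 /path_weight big_ord0.
by rewrite sum_path_weightS; under eq_bigr do rewrite mulr1.
Qed.

Lemma sum_path_weight_le v (rho : nat -> R) n :
  (forall p, 0 <= path_weight v p) -> (forall i, 0 <= rho i) ->
  (forall i x, x \in reachable i -> v i x <= rho i) ->
  \sum_(p <- jump_paths n) path_weight v p <= \prod_(i < n) rho i.
Proof.
move=> wt_ge0 rho_ge0 v_le; elim: n => [|n IH].
  by rewrite big_seq1 /path_weight !big_ord0.
rewrite sum_path_weightS big_ord_recr/=; apply: le_trans (ler_wpM2r _ IH) => //.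
rewrite mulr_suml big_seq [leRHS]big_seq; apply: ler_sum => p pn.
by rewrite ler_wpM2l// v_le// map_f.
Qed.

End JumpPaths.

Section TailStep.
Context {R : realType} {J : finType}.
Implicit Types c s : J -> R.

Definition tail_step c s (x : \bar R) : R := \sum_j c j * ((s j)%:E < x)%E%:R.

(* For [s >= 0], the mean of [tail_step c s X] when [X] is an exponential
   variable of rate [r]. *)
Definition tail_step_mean c s (r : R) : R := \sum_j c j * expR (- r * s j).

Lemma measurable_tail_step {d} {Omega : measurableType d} c s
  (X : Omega -> \bar R) : measurable_fun setT X ->
  measurable_fun setT (tail_step c s \o X).
Proof.
move=> mX; apply: measurable_sum => j; apply: measurable_funM => //.
rewrite (_ : (fun w => _) = \1_[set w | (s j)%:E < X w]%E); last first.
  by apply/funext => w; rewrite indicE mem_setE.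
apply: measurable_indic; rewrite -[X in measurable X]setTI.
exact: emeasurable_fun_o_infty.
Qed.

End TailStep.

Section JumpTimes.
Context {R : realType} {Omega : Type} (xi : nat -> Omega -> \bar R).

Definition jumped_by (t : R) (n : nat) : set Omega :=
  [set w | (jump_time xi n w <= t%:E)%E].

Definition last_jump_by (t : R) (w : Omega) (n : nat) : Prop :=
  jumped_by t n w /\ forall i, jumped_by t i w -> (i <= n)%N.

Lemma ex_last_jump_by t w : 0 <= t ->
  ~ (forall n, exists2 i, (n <= i)%N & jumped_by t i w) ->
  exists n, last_jump_by t w n.
Proof.
move=> t_ge0 /existsNP[n no_jump].
have ex : exists i, (jump_time xi i w <= t%:E)%E.
  by exists 0%N; rewrite /jump_time big_geq// lee_fin.
have ub i : (jump_time xi i w <= t%:E)%E -> (i <= n)%N.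
  move=> ti; rewrite leqNgt; apply/negP => ni; apply: no_jump.
  by exists i => //; exact: ltnW.
by case: (ex_maxnP ex ub) => i ti imax; exists i.
Qed.

End JumpTimes.

Section JumpChain.
Context {R : realType} {T : choiceType} {d : measure_display}
  {Omega : measurableType d} (P : probability Omega R).
Context (x0 : T) (pi : T -> T -> R) (q : T -> R).
Context (h : nat -> Omega -> T) (xi : nat -> Omega -> \bar R).

(* [is_IPS] is an instance of this law, up to conversion. *)
Definition jump_law : Prop :=
  (forall n g, measurable [set w | h n w = g]) /\
  (forall n, measurable_fun setT (xi n)) /\
  (forall (n : nat) (g : nat -> T) (s : nat -> R),
     (forall i, 0 <= s i) ->
     P [set w | (forall i, (i <= n)%N -> h i w = g i) /\
                (forall i, (1 <= i <= n)%N -> ((s i)%:E < xi i w)%E)]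
     = ((`[< g 0%N = x0 >])%:R *
        \prod_(1 <= i < n.+1)
           (pi (g i.-1) (g i) * expR (- q (g i.-1) * s i)))%:E).

Hypothesis law : jump_law.

Definition follows (p : seq T) : set Omega :=
  [set w | forall i, (i <= size p)%N -> h i w = nth x0 (x0 :: p) i].

Definition path_tail (p : seq T) (s : nat -> R) : set Omega :=
  follows p `&`
  [set w | forall i, (i < size p)%N -> ((s i)%:E < xi i.+1 w)%E].

Lemma trivIset_path_tail n s : trivIset [set p | size p = n] (path_tail^~ s).
Proof.
move=> p p' /= pn p'n [w [[fp _] [fp' _]]]; apply: (@eq_from_nth _ x0).
  by rewrite pn p'n.
by move=> i ip; have := fp' i.+1; rewrite p'n -pn ip fp// => /(_ erefl).
Qed.

Lemma measurable_follows p : measurable (follows p).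
Proof. by apply: bigcap_measurableType => // i _; exact: law.1. Qed.

Lemma measurable_path_tail p s : measurable (path_tail p s).
Proof.
apply: measurableI; first exact: measurable_follows.
apply: bigcap_measurableType => // i _; rewrite -[X in measurable X]setTI.
by apply: emeasurable_fun_o_infty => //; exact: law.2.1.
Qed.

Lemma indic_path_tail p s w : \1_(path_tail p s) w =
  \1_(follows p) w * \prod_(i < size p) ((s i)%:E < xi i.+1 w)%E%:R :> R.
Proof.
rewrite indicI /=; congr (_ * _); rewrite indicE /in_mem/= /in_set.
case: asboolP => [tp|/existsNP[i /not_implyP[ip /negP/negbTE xi_le]]].
  by rewrite big1// => i _; rewrite tp.
by rewrite (bigD1 (Ordinal ip))//= xi_le mul0r.
Qed.

Lemma prob_path_tail p s : (forall i, 0 <= s i) ->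
  P (path_tail p s) = (path_weight x0 pi (fun i x => expR (- q x * s i)) p)%:E.
Proof.
move=> s_ge0.
have := law.2.2 (size p) (nth x0 (x0 :: p)) (s \o predn) (fun=> s_ge0 _).
rewrite asboolT// mul1r big_add1 big_mkord => <-; congr (P _).
apply/seteqP; split=> w [hp tp]; split=> //.
  by case=> // i /andP[_]; exact: tp.
by move=> i ip; have := tp i.+1; rewrite ip; exact.
Qed.

Section PathSteps.
Context {J : finType} (c s : nat -> J -> R).
Hypothesis s_ge0 : forall i j, 0 <= s i j.

Definition path_step (p : seq T) (w : Omega) : R :=
  \1_(follows p) w * \prod_(i < size p) tail_step (c i) (s i) (xi i.+1 w).

Lemma measurable_path_step p : measurable_fun setT (path_step p).
Proof.
apply: measurable_funM.
  by apply: measurable_indic; exact: measurable_follows.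
by apply: measurable_prod => i _; apply: measurable_tail_step; exact: law.2.1.
Qed.

Let threshold n (f : {ffun 'I_n -> J}) (i : nat) : R :=
  if insub i is Some o then s i (f o) else 0.

Let thresholdE n (f : {ffun 'I_n -> J}) (i : 'I_n) :
  threshold f i = s i (f i).
Proof. by rewrite /threshold valK. Qed.

Let path_step_indic p w : path_step p w =
  \sum_(f : {ffun 'I_(size p) -> J})
    (\prod_(i < size p) c i (f i)) * \1_(path_tail p (threshold f)) w.
Proof.
rewrite /path_step /tail_step bigA_distr_bigA mulr_sumr; apply: eq_bigr => f _.
rewrite big_split/= mulrCA indic_path_tail; congr (_ * (_ * _)).
by apply: eq_bigr => i _; rewrite thresholdE.
Qed.

(* Expanding the product of the step functions turns the integral into a sum of
   probabilities of tail events, one for each choice of a summand per jump. *)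
Lemma integral_path_step p : (\int[P]_w (path_step p w)%:E =
  (path_weight x0 pi (fun i x => tail_step_mean (c i) (s i) (q x)) p)%:E)%E.
Proof.
under eq_integral do rewrite path_step_indic.
rewrite integral_sum_indic => [|f]; last exact: measurable_path_tail.
rewrite /path_weight big_split/= /tail_step_mean bigA_distr_bigA mulr_sumr.
rewrite -sumEFin.
apply: eq_bigr => f _; rewrite prob_path_tail; last first.
  by move=> i; rewrite /threshold; case: insub.
rewrite -EFinM; congr EFin; rewrite /path_weight !big_split/= mulrCA.
by under [X in _ * (_ * X)]eq_bigr do rewrite thresholdE.
Qed.

End PathSteps.

Lemma measurable_jump_time n : measurable_fun setT (jump_time xi n).
Proof. by apply: emeasurable_sum => i; exact: law.2.1. Qed.

Lemma measurable_jumped_by t n : measurable (jumped_by xi t n).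
Proof.
rewrite -[X in measurable X]setTI.
by apply: emeasurable_fun_infty_c => //; exact: measurable_jump_time.
Qed.

Section Reachable.
Context (succ : T -> seq T).
Hypothesis uniq_succ : forall x, uniq (succ x).
Hypothesis sum_pi : forall n x, x \in reachable x0 succ n ->
  \sum_(y <- succ x) pi x y = 1.

Lemma negligible_off_jump_paths n : P.-negligible
  (~` \bigcup_(p in [set` jump_paths x0 succ n]) path_tail p (fun=> 0)).
Proof.
set U := \bigcup_(p in _) _.
have mU : measurable U.
  by apply: fin_bigcup_measurable => // p _; exact: measurable_path_tail.
exists (~` U); split=> //; first exact: measurableC.
suff PU : P U = 1%E by rewrite probability_setC// PU subee.
rewrite (measure_fin_bigcup _ (finite_seq (jump_paths x0 succ n)));
  last 2 first.
- apply: (sub_trivIset _ (@trivIset_path_tail n _)) => p.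
  exact: size_jump_paths.
- by move=> p _; exact: measurable_path_tail.
rewrite -fsbig_seq; last exact: jump_paths_uniq.
transitivity (\sum_(p <- jump_paths x0 succ n)
    (path_weight x0 pi (fun _ _ => 1) p)%:E)%E; last first.
  by rewrite sumEFin sum_path_weight1.
apply: eq_bigr => p _; rewrite [LHS]prob_path_tail//; congr EFin.
by apply: eq_bigr => i _; rewrite mulr0 expR0.
Qed.

Lemma negligible_off_reachable :
  P.-negligible [set w | ~ forall n, h n w \in reachable x0 succ n].
Proof.
apply: negligibleS (negligible_bigcup negligible_off_jump_paths).
move=> w /existsNP[n hn]; exists n => // -[p pn [hp _]]; apply: hn.
apply/mapP; exists p => //.
by rewrite (last_nth x0) (size_jump_paths pn) -hp ?(size_jump_paths pn).
Qed.

Section Chernoff.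
Context (theta t : R) (s rho : nat -> R).
Hypotheses (theta_ge0 : 0 <= theta) (s_ge0 : forall i, 0 <= s i).
Hypothesis rho_ge0 : forall i, 0 <= rho i.
Hypothesis rho_ge : forall i x, x \in reachable x0 succ i ->
  1 - (1 - expR (- theta * s i)) * expR (- q x * s i) <= rho i.

(* The corresponding step function is [1] on [0 < x <= s i] and
   [expR (- theta * s i)] on [s i < x], hence above [expR (- theta * x)] for
   positive [x]. *)
Let chernoff_coef i (b : bool) : R :=
  if b then 1 else expR (- theta * s i) - 1.
Let chernoff_level i (b : bool) : R := if b then 0 else s i.

Let chernoff_stepE i (x : \bar R) :
  tail_step (chernoff_coef i) (chernoff_level i) x =
  if (0 < x)%E then expR (- theta * (if ((s i)%:E < x)%E then s i else 0))
  else 0.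
Proof.
rewrite /tail_step big_bool /= mul1r.
case: ifPn => [x_gt0|]; last first.
  rewrite -leNgt => x_le0; rewrite ltNge (le_trans x_le0) ?lee_fin//=.
  by rewrite mulr0 addr0.
by case: ifPn => _; rewrite ?mulr1 ?mulr0 ?expR0 ?addr0// addrCA subrr addr0.
Qed.

Let chernoff_meanE i r : tail_step_mean (chernoff_coef i) (chernoff_level i) r =
  1 - (1 - expR (- theta * s i)) * expR (- r * s i).
Proof.
by rewrite /tail_step_mean big_bool /= mulr0 expR0 mulr1 -mulNr opprB.
Qed.

Let chernoff_path := path_step chernoff_coef chernoff_level.

Let measurable_chernoff_path p :
  measurable_fun setT (fun w => (chernoff_path p w)%:E).
Proof. by apply/measurable_EFinP; exact: measurable_path_step. Qed.

Let chernoff_path_ge0 p w : 0 <= chernoff_path p w.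
Proof.
apply: mulr_ge0 => //; apply: prodr_ge0 => i _; rewrite chernoff_stepE//.
by case: ifP => // _; exact: expR_ge0.
Qed.

Let chernoff_path_ge1 p w :
  path_tail p (fun=> 0) w -> jumped_by xi t (size p) w ->
  1 <= expR (theta * t) * chernoff_path p w.
Proof.
move=> [fp xi_gt0] tau_le.
pose elapsed i := if ((s i)%:E < xi i.+1 w)%E then s i else 0.
rewrite /chernoff_path /path_step indicE mem_set// mul1r.
under eq_bigr => i _ do rewrite chernoff_stepE// xi_gt0// -/(elapsed i).
rewrite -expR_sum -mulr_sumr -expRD -expR0 ler_expR mulNr -mulrBr mulr_ge0//.
rewrite subr_ge0 -lee_fin; apply: le_trans tau_le.
rewrite /jump_time big_add1 big_mkord -sumEFin; apply: lee_sum => i _.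
by rewrite /elapsed; case: ifPn => [/ltW//|_]; exact/ltW/xi_gt0.
Qed.

Let integral_chernoff_path p : (\int[P]_w (chernoff_path p w)%:E =
  (path_weight x0 pi
     (fun i x => 1 - (1 - expR (- theta * s i)) * expR (- q x * s i)) p)%:E)%E.
Proof.
rewrite integral_path_step; last by move=> i; case=> /=.
by congr EFin; apply: eq_bigr => i _; rewrite chernoff_meanE.
Qed.

Lemma prob_jumped_by_le n : (P (jumped_by xi t n) <=
  (expR (theta * t) * \prod_(i < n) rho i)%:E)%E.
Proof.
pose S w := (\sum_(p <- jump_paths x0 succ n) (chernoff_path p w)%:E)%E.
have mS : measurable_fun setT S by exact: emeasurable_sum.
have S_ge0 w : (0 <= S w)%E by rewrite sume_ge0// => p _; rewrite lee_fin.
have e_ge0 : 0 <= expR (theta * t) by exact: expR_ge0.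
have -> : P (jumped_by xi t n) = (\int[P]_w (\1_(jumped_by xi t n) w)%:E)%E.
  by rewrite integral_indic// ?setIT//; exact: measurable_jumped_by.
apply: (@le_trans _ _ (\int[P]_w ((expR (theta * t))%:E * S w))%E).
  apply: (le_integral_off_negligible (negligible_off_jump_paths n)).
  - by move=> w; rewrite lee_fin.
  - by move=> w; rewrite mule_ge0.
  - exact: measurable_funeM.
  move=> w /contrapT[p pn tp]; rewrite indicE.
  have [/set_mem/= tau_le|_] := boolP (w \in _); last by rewrite mule_ge0.
  rewrite /S sumEFin -EFinM lee_fin (bigD1_seq p)//= ?jump_paths_uniq//.
  rewrite mulrDr ler_wpDr ?mulr_ge0 ?sumr_ge0// chernoff_path_ge1//.
  by rewrite (size_jump_paths pn).
rewrite ge0_integralZl_EFin// /S ge0_integral_sum//; last first.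
  by move=> p w _; rewrite lee_fin.
under eq_bigr do rewrite integral_chernoff_path.
rewrite sumEFin -EFinM lee_fin ler_wpM2l//.
apply: sum_path_weight_le => // p; rewrite -lee_fin -integral_chernoff_path.
by rewrite integral_ge0// => w _; rewrite lee_fin.
Qed.

End Chernoff.

Section LinearRates.
Context (L : R) (t : R).
Hypothesis L_gt0 : 0 < L.
Hypothesis q_le : forall n x, x \in reachable x0 succ n -> q x <= L * n.+1%:R.

Lemma prob_jumped_by_decay r n (k := r%:R * expR 1) : (0 < r)%N ->
  (P (jumped_by xi t n) <= (expR (L * k * t) * (k / (n%:R + k)) ^+ r)%:E)%E.
Proof.
move=> r_gt0; have k_gt0 : 0 < k by rewrite mulr_gt0 ?ltr0n ?expR_gt0.
pose s i : R := (L * i.+1%:R)^-1.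
pose rho i : R := ((i%:R + k) / (i.+1%:R + k)) ^+ r.
have rho_ge0 i : 0 <= rho i by rewrite exprn_ge0// divr_ge0// addr_ge0// ltW.
rewrite -prod_shifted_ratio// -prodrXl.
apply: (@prob_jumped_by_le (L * k) t s rho) => // [|i|i x xi_reach].
- by rewrite mulr_ge0// ltW.
- by rewrite invr_ge0 mulr_ge0// ltW.
have i1_gt0 : 0 < i.+1%:R :> R by [].
rewrite mulNr (_ : L * k * s i = k / i.+1%:R); last first.
  by rewrite /s invfM mulrACA divff ?gt_eqF// mul1r.
rewrite /rho -[i%:R](addrK 1) natr1.
apply: chernoff_factor_le; first by rewrite ler1n.
rewrite ler_expR mulNr lerN2 ler_pdivrMr ?mulr_gt0// mul1r.
exact: q_le.
Qed.

Lemma jumped_by_moment_lty p :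
  (\sum_(0 <= n <oo) (n.+1%:R ^+ p)%:E * P (jumped_by xi t n) < +oo)%E.
Proof.
pose k : R := p.+2%:R * expR 1; pose C := expR (L * k * t) * k ^+ p.+2.
have k_ge1 : 1 <= k.
  by rewrite mulr_ege1 ?ler1n//; apply: le_trans (expR_ge1Dx 1); rewrite lerDl.
have k_gt0 : 0 < k by exact: lt_le_trans k_ge1.
have C_ge0 : 0 <= C by rewrite mulr_ge0 ?expR_ge0// exprn_ge0// ltW.
apply: (@le_lt_trans _ _ (\sum_(0 <= n <oo) C%:E * (n.+1%:R ^- 2)%:E)%E);
    last first.
  rewrite nneseriesZl => [|n _]; last by rewrite lee_fin.
  by rewrite lte_mul_pinfty// nneseries_inv_sqr_lty.
apply: lee_nneseries => n _; first by rewrite mule_ge0// lee_fin exprn_ge0.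
apply: le_trans (lee_wpmul2l _ (prob_jumped_by_decay n (ltn0Sn p.+1))) _.
  by rewrite lee_fin exprn_ge0.
rewrite -/k -EFinM lee_fin expr_div_n [expR _ * (_ * _)]mulrA -/C.
have n1_neq0 : n.+1%:R ^+ p != 0 :> R by rewrite expf_neq0.
apply: (@le_trans _ _ (n.+1%:R ^+ p * (C / n.+1%:R ^+ p.+2))).
  apply: ler_wpM2l; first by rewrite exprn_ge0.
  apply: ler_wpM2l => //; rewrite lef_pV2 ?posrE ?exprn_gt0// ?ltr_wpDl//.
  by rewrite lerXn2r ?nnegrE ?addr_ge0 ?(ltW k_gt0)// -natr1 lerD2l.
by rewrite -addn2 exprD invfM mulrCA mulVKf.
Qed.

Lemma negligible_infinitely_many_jumps :
  P.-negligible [set w | forall n, exists2 i, (n <= i)%N & jumped_by xi t i w].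
Proof.
exists (lim_sup_set (jumped_by xi t)); split.
- apply: bigcap_measurableType => n _; apply: bigcup_measurable => i _.
  exact: measurable_jumped_by.
- apply: lim_sup_set_cvg0 => [n|]; first exact: measurable_jumped_by.
  apply: le_lt_trans (jumped_by_moment_lty 0); apply: lee_nneseries => // n _.
  by rewrite expr0 mul1e.
- by move=> w inf_w n _; have [i ni iw] := inf_w n; exists i.
Qed.

Lemma integral_poly_jumps_lty (u : Omega -> \bar R) (B : R) p :
  0 <= t -> 0 <= B -> (forall w, 0 <= u w)%E ->
  (forall w n, last_jump_by xi t w n -> h n w \in reachable x0 succ n ->
    u w <= (B * n.+1%:R ^+ p)%:E)%E ->
  (\int[P]_w u w < +oo)%E.
Proof.
move=> t_ge0 B_ge0 u_ge0 u_le.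
pose v n w : \bar R := ((B * n.+1%:R ^+ p)%:E * (\1_(jumped_by xi t n) w)%:E)%E.
have v_ge0 n w : (0 <= v n w)%E.
  by rewrite /v -EFinM lee_fin !mulr_ge0 ?exprn_ge0.
have measurable_indic_jumped_by n :
    measurable_fun setT (fun w => (\1_(jumped_by xi t n) w)%:E : \bar R).
  by apply/measurable_EFinP/measurable_indic/measurable_jumped_by.
have mv n : measurable_fun setT (v n) by exact: measurable_funeM.
apply: (@le_lt_trans _ _ (\int[P]_w \sum_(0 <= n <oo) v n w)%E).
  apply: le_integral_off_negligible _ _ _ _ => //.
  - exact: negligibleU negligible_infinitely_many_jumps
                       negligible_off_reachable.
  - by move=> w; exact: nneseries_ge0.
  - exact: ge0_emeasurable_sum.
  move=> w /not_orP[fin_w /contrapT reach_w].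
  have [n wn] := ex_last_jump_by t_ge0 fin_w.
  apply: le_trans (u_le w n wn (reach_w n)) _.
  rewrite (nneseriesD1 (n := n))// (_ : v n w = (B * n.+1%:R ^+ p)%:E).
    by rewrite leeDl// nneseries_ge0.
  by rewrite /v indicE mem_set ?mule1//; exact: wn.1.
rewrite integral_nneseries//.
have integral_v n : (\int[P]_w v n w =
    B%:E * ((n.+1%:R ^+ p)%:E * P (jumped_by xi t n)))%E.
  rewrite ge0_integralZl_EFin//; last by rewrite mulr_ge0 ?exprn_ge0.
  by rewrite integral_indic ?setIT ?EFinM ?muleA//; exact: measurable_jumped_by.
under eq_eseriesr => n _ do rewrite integral_v.
rewrite nneseriesZl => [|n _]; last by rewrite mule_ge0// lee_fin exprn_ge0.
by rewrite lte_mul_pinfty// jumped_by_moment_lty.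
Qed.

End LinearRates.
End Reachable.
End JumpChain.

Section ObservableAtTime.
Context {R : realType} {V E : countType} {Omega : Type}.
Context (h : nat -> Omega -> state V E) (xi : nat -> Omega -> \bar R).

Lemma ips_normp_at_ge0 normp t w :
  (forall g, 0 <= normp g) -> (0 <= ips_normp_at h xi normp t w)%E.
Proof.
move=> normp_ge0; rewrite /ips_normp_at.
by case: pselect => // H; rewrite lee_fin.
Qed.

Lemma ips_normp_at_last_jump normp t w n :
  last_jump_by xi t w n -> ips_normp_at h xi normp t w = (normp (h n w))%:E.
Proof.
move=> [tn n_max]; rewrite /ips_normp_at.
case: pselect => [H|[]]; last by exists n.
case: cid => /= i [ti i_max]; congr (normp (h _ w))%:E.
by apply/eqP; rewrite eqn_leq n_max ?i_max.
Qed.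

End ObservableAtTime.

Lemma fsum_seqE {R : nmodType} {I : choiceType} (S : set I) (X : seq I)
    (r : I -> R) : uniq X -> (forall x, x \notin X -> r x = 0) ->
  \sum_(x \in S) r x = \sum_(x <- X | x \in S) r x.
Proof.
move=> uX rX; rewrite (@fsbigE _ _ _ _ _ [seq x <- X | x \in S]).
- by rewrite big_filter_cond; under eq_bigl do rewrite andbb.
- exact: filter_uniq.
- by move=> x /=; rewrite mem_filter => /andP[/set_mem].
- move=> x Sx; rewrite mem_filter negb_and => /orP[|/rX//].
  by rewrite mem_set.
Qed.

Lemma sum_fsum_fibers {R : nmodType} {I T : choiceType} (F : I -> T)
    (r : I -> R) (L : seq T) (Q : set T) :
  finite_set [set x | r x != 0] -> uniq L ->
  (forall x, r x != 0 -> F x \in L) ->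
  \sum_(y <- L | y \in Q) \sum_(x \in F @^-1` [set y]) r x =
  \sum_(x \in F @^-1` Q) r x.
Proof.
move=> fin_r uniq_L FL; set X := finmap.enum_fset (fset_set [set x | r x != 0]).
have uniq_X : uniq X by exact: finmap.fset_uniq.
have memX x : (x \in X) = (r x != 0).
  by rewrite [LHS]in_fset_set//; apply/idP/idP => [/set_mem|/mem_set].
have r_out x : x \notin X -> r x = 0 by rewrite memX negbK => /eqP.
rewrite (fsum_seqE _ uniq_X r_out).
under eq_bigr => y _ do rewrite (fsum_seqE _ uniq_X r_out) big_mkcond.
rewrite exchange_big [RHS]big_mkcond/= [LHS]big_seq [RHS]big_seq.
apply: eq_bigr => x; rewrite memX => /FL Fx_L.
have fiberE y : (x \in F @^-1` [set y]) = (y == F x).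
  by apply/idP/eqP => [/set_mem|->]; [|exact: mem_set].
rewrite big_mkcond (bigD1_seq (F x))//= fiberE eqxx.
rewrite big1 ?addr0// => y /negbTE yF.
by rewrite fiberE yF if_same.
Qed.

Lemma leq_sum_support {I : choiceType} (u : I -> nat) (s S : seq I) :
  uniq s -> uniq S -> (forall x, u x != 0 -> x \in S)%N ->
  (\sum_(x <- s) u x <= \sum_(x <- S) u x)%N.
Proof.
move=> us uS uSupp; rewrite -(big_rmcond (mem S)) => [|x]; last first.
  by apply: contraNeq; exact: uSupp.
rewrite -big_filter.
apply: (uniq_sub_le_big leqnn (fun m n => leq_addr n m)) => // [|x].
  exact: filter_uniq.
by rewrite mem_filter => /andP[].
Qed.

Lemma finite_support_of_sum_le {I : choiceType} (u : I -> int) (K : nat) :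
  (forall s, uniq s -> \sum_(x <- s) `|u x| <= K)%N ->
  finite_set [set x | u x != 0].
Proof.
move=> uK; apply: contrapT => /(infinite_set_fset K.+1)[B Bu].
apply/negP; rewrite -ltnNge ltnS.
apply: leq_trans (uK _ (finmap.fset_uniq B)).
rewrite -sum1_size [leqLHS]big_seq [leqRHS]big_seq; apply: leq_sum => x xB.
by rewrite lt0n absz_eq0; exact: (Bu x).
Qed.

Section TotalMass.
Context {V E : countType} (src dst : E -> V) (V0 : set V).

Definition degree_le (D : nat) : Prop :=
  forall (x : V) (s : seq E), uniq s ->
    (forall e, e \in s -> src e = x \/ dst e = x) -> (size s <= D)%N.

(* Bounding all finite partial sums avoids sums over infinite index sets, and
   forces finite supports. *)
Definition mass_le (K : nat) (g : state V E) : Prop :=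
  forall (sV : seq V) (sE : seq E), uniq sV -> uniq sE ->
    (\sum_(x <- sV) `|g.1 x| + \sum_(e <- sE) `|g.2 e| <= K)%N.

Lemma mass_leW K K' g : (K <= K')%N -> mass_le K g -> mass_le K' g.
Proof. by move=> KK' Kg sV sE uV uE; exact: leq_trans (Kg _ _ uV uE) KK'. Qed.

Lemma mass_le_node K g x : mass_le K g -> (`|g.1 x| <= K)%N.
Proof. by move=> /(_ [:: x] [::] isT isT); rewrite big_seq1 big_nil addn0. Qed.

Lemma mass_le_edge K g e : mass_le K g -> (`|g.2 e| <= K)%N.
Proof. by move=> /(_ [::] [:: e] isT isT); rewrite big_seq1 big_nil add0n. Qed.

Lemma ex_mass_le g : F0 g -> exists K, mass_le K g.
Proof.
move=> [/finite_seqP[sV sVE] /finite_seqP[sE sEE]].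
exists (\sum_(x <- undup sV) `|g.1 x| + \sum_(e <- undup sE) `|g.2 e|)%N.
move=> tV tE uV uE; apply: leq_add; apply: leq_sum_support => //;
  rewrite ?undup_uniq// => x; rewrite absz_eq0 mem_undup => gx.
  by have : [set` sV] x by rewrite -sVE.
by have : [set` sE] x by rewrite -sEE.
Qed.

Lemma mass_le_F0 K g : mass_le K g -> F0 g.
Proof.
move=> Kg; split; apply: (@finite_support_of_sum_le _ _ K) => s us.
  by have := Kg s [::] us isT; rewrite big_nil addn0.
by have := Kg [::] s isT us; rewrite big_nil add0n.
Qed.

Lemma mass_le_node_move D x K g : degree_le D ->
  mass_le K g -> mass_le (K + D) (node_move src dst x g).
Proof.
move=> degD Kg sV sE uV uE; apply: leq_trans (leq_add (Kg sV sE uV uE)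
  (degD x [seq e <- sE | (src e == x) || (dst e == x)] _ _)).
- rewrite -addnA leq_add2l size_filter -sum1_count.
  rewrite [X in (_ <= _ + X)%N]big_mkcond -big_split/=; apply: leq_sum => e _.
  by case: (src e == x); case: (dst e == x); case: sgzP => _ /=; lia.
- exact: filter_uniq.
- by move=> e; rewrite mem_filter => /andP[/orP[]/eqP ->]; [left|right].
Qed.

Lemma mass_le_edge_move e K g :
  mass_le K g -> mass_le (K + 2) (edge_move src dst V0 e g).
Proof.
move=> Kg sV sE uV uE.
have cnt z : (count_mem z sV <= 1)%N by rewrite count_uniq_mem// leq_b1.
apply: leq_trans (leq_add (Kg sV sE uV uE)
  (leq_add (cnt (src e)) (cnt (dst e)))).
rewrite addnAC leq_add2r -!sum1_count (big_mkcond (pred1 _)).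
rewrite [X in (_ <= _ + (_ + X))%N]big_mkcond -!big_split/=.
apply: leq_sum => z _.
by case: (z == src e); case: (z == dst e); case: (z \in V0); case: sgzP => _ /=;
  lia.
Qed.

End TotalMass.

Lemma fsum_le_finite_support {R : realDomainType} {I : choiceType} (S : set I)
    (F : I -> R) (u : I -> nat) (c : R) : (forall x, F x <= c * (u x)%:R) ->
  \sum_(x \in S) F x <= c * (\sum_(x <- finite_support 0%R S F) u x)%N%:R.
Proof. by move=> Fu; rewrite natr_sum mulr_sumr; apply: ler_sum. Qed.

Lemma fsum_mass_le {R : realDomainType} {V E : countType} (g : state V E)
    (K : nat) (A : set V) (B : set E) (F : V -> R) (G : E -> R) (c : R) :
  0 <= c -> mass_le K g -> (forall x, F x <= c * `|g.1 x|%:~R) ->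
  (forall e, G e <= c * `|g.2 e|%:~R) ->
  \sum_(x \in A) F x + \sum_(e \in B) G e <= c * K%:R.
Proof.
move=> c0 Kg Fg Gg.
have Fg' x : F x <= c * `|g.1 x|%N%:R by rewrite natr_absz.
have Gg' e : G e <= c * `|g.2 e|%N%:R by rewrite natr_absz.
apply: le_trans (lerD (fsum_le_finite_support A Fg')
  (fsum_le_finite_support B Gg')) _.
rewrite -mulrDr -natrD ler_wpM2l// ler_nat.
by apply: Kg; exact: finite_support_uniq.
Qed.

Lemma powR_absz_le {R : realType} (K p : nat) (alpha : R) (z : int) :
  0 < alpha <= p.+1%:R -> (`|z| <= K)%N ->
  `|z|%:~R `^ alpha <= K%:R ^+ p * `|z|%:~R :> R.
Proof.
move=> alpha_le zK; rewrite -natr_absz.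
apply: le_trans (powR_natr_le_exp _ alpha_le) _.
by rewrite exprSr ler_wpM2r// lerXn2r ?nnegrE// ler_nat.
Qed.

Section IPS.
Context {R : realType} {V E : countType} (src dst : E -> V) (V0 : set V)
  (m : V -> R) (k : E -> R).

Definition ips_succ (g : state V E) : seq (state V E) :=
  undup (g ::
    [seq node_move src dst x g
       | x <- finmap.enum_fset (fset_set [set x | g.1 x != 0])] ++
    [seq edge_move src dst V0 e g
       | e <- finmap.enum_fset (fset_set [set e | g.2 e != 0])]).

Lemma ips_succ_uniq g : uniq (ips_succ g).
Proof. exact: undup_uniq. Qed.

Lemma ips_succ_node_move g x : finite_set [set x | g.1 x != 0] ->
  g.1 x != 0 -> node_move src dst x g \in ips_succ g.
Proof.
move=> fin_g gx; rewrite mem_undup inE mem_cat.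
rewrite (map_f (node_move src dst ^~ g)) ?orbT//.
by rewrite [_ \in _]in_fset_set//; exact: mem_set.
Qed.

Lemma ips_succ_edge_move g e : finite_set [set e | g.2 e != 0] ->
  g.2 e != 0 -> edge_move src dst V0 e g \in ips_succ g.
Proof.
move=> fin_g ge; rewrite mem_undup inE mem_cat.
rewrite (map_f (edge_move src dst V0 ^~ g)) ?orbT//.
by rewrite [_ \in _]in_fset_set//; exact: mem_set.
Qed.

Lemma sum_ips_jump g : F0 g ->
  \sum_(g' <- ips_succ g) ips_jump src dst V0 m k g g' = 1.
Proof.
move=> [finV finE]; pose Q := ips_qtot src dst V0 m k g.
have [Q0|Q_neq0] := eqVneq Q 0.
  rewrite (bigD1_seq g) ?ips_succ_uniq ?mem_undup ?mem_head//=.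
  rewrite big1 => [|g' /eqP g'g].
    by rewrite /ips_jump -/Q Q0 eqxx asboolT// addr0.
  by rewrite /ips_jump -/Q Q0 eqxx asboolF.
have node_neq0 x : `|g.1 x|%:~R / m x != 0 -> g.1 x != 0.
  by apply: contraNN => /eqP ->; rewrite normr0 mul0r.
have edge_neq0 e : k e * `|g.2 e|%:~R != 0 -> g.2 e != 0.
  by apply: contraNN => /eqP ->; rewrite normr0 mulr0.
transitivity ((\sum_(g' <- ips_succ g | g' \in ~` [set g])
    ips_rate src dst V0 m k g g') / Q); last first.
  rewrite /ips_rate big_split/= !sum_fsum_fibers ?ips_succ_uniq//.
  - exact: divff.
  - exact: sub_finite_set edge_neq0 finE.
  - by move=> e /edge_neq0; exact: ips_succ_edge_move.
  - exact: sub_finite_set node_neq0 finV.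
  - by move=> x /node_neq0; exact: ips_succ_node_move.
rewrite mulr_suml [RHS]big_mkcond; apply: eq_bigr => g' _.
rewrite /ips_jump -/Q (negbTE Q_neq0) in_setC -[g' \in _]/(`[< g' = g >]).
by case: asboolP.
Qed.

Lemma mass_le_ips_succ D K g g' : degree_le src dst D ->
  mass_le K g -> g' \in ips_succ g -> mass_le (K + (D + 2)) g'.
Proof.
move=> degD Kg; rewrite mem_undup inE mem_cat.
case/or3P => [/eqP ->|/mapP[x _ ->]|/mapP[e _ ->]].
- by apply: mass_leW Kg; rewrite leq_addr.
- apply: mass_leW (mass_le_node_move x degD Kg).
  by rewrite leq_add2l leq_addr.
- apply: mass_leW (mass_le_edge_move src dst V0 e Kg).
  by rewrite leq_add2l leq_addl.
Qed.

Lemma mass_le_reachable D K f n g : degree_le src dst D -> mass_le K f ->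
  (D + 2 <= K)%N -> g \in reachable f ips_succ n -> mass_le (K * n.+1) g.
Proof.
move=> degD Kf DK; move: n g; apply: reachable_ind => [|n g g' Kg g'_succ].
  by rewrite muln1.
apply: mass_leW (mass_le_ips_succ degD Kg g'_succ).
by rewrite [(K * n.+2)%N]mulnS addnC leq_add2r.
Qed.

Context (M : R).
Hypothesis M_gt0 : 0 < M.
Hypotheses (m_pos : forall x, 0 < m x) (k_ge0 : forall e, 0 <= k e).
Hypotheses (m_inv_le : forall x, (m x)^-1 <= M) (k_le : forall e, k e <= M).

Lemma ips_qtot_le K g : mass_le K g -> ips_qtot src dst V0 m k g <= M * K%:R.
Proof.
move=> Kg; apply: (fsum_mass_le _ _ (ltW M_gt0) Kg) => [x|e].
  by rewrite mulrC ler_wpM2r// ler0z.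
by rewrite ler_wpM2r// ler0z.
Qed.

Lemma ips_normp_le (K p : nat) (alpha : R) g : 0 < alpha <= p.+1%:R ->
  mass_le K g -> ips_normp m k alpha g <= M * K%:R ^+ p.+1.
Proof.
move=> alpha_le Kg; rewrite exprSr mulrA.
have c_ge0 : 0 <= M * K%:R ^+ p by rewrite mulr_ge0 ?exprn_ge0// ltW.
apply: (fsum_mass_le _ _ c_ge0 Kg) => [x|e]; rewrite -mulrA.
  rewrite mulrC ler_pM ?powR_ge0 ?invr_ge0 ?(ltW (m_pos x))//.
  by apply: powR_absz_le => //; exact: mass_le_node.
rewrite ler_pM ?powR_ge0//.
by apply: powR_absz_le => //; exact: mass_le_edge.
Qed.

Lemma ips_normp_ge0 (alpha : R) g : 0 <= ips_normp m k alpha g.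
Proof.
apply: addr_ge0; apply: sumr_ge0 => x _.
  by rewrite divr_ge0 ?powR_ge0// ltW.
by rewrite mulr_ge0 ?powR_ge0.
Qed.

Context (D K : nat).
Hypotheses (degD : degree_le src dst D) (DK : (D + 2 <= K)%N).
Context {d : measure_display} {Omega : measurableType d}
  (P : probability Omega R).
Context (f : state V E) (h : nat -> Omega -> state V E)
  (xi : nat -> Omega -> \bar R).
Hypotheses (f_mass : mass_le K f) (law : is_IPS src dst V0 m k P f h xi).

Lemma integral_ips_normp_at_lty p alpha t :
  0 < alpha <= p.+1%:R -> 0 <= t ->
  (\int[P]_w ips_normp_at h xi (ips_normp m k alpha) t w < +oo)%E.
Proof.
move=> alpha_le t_ge0.
have mass_reach n g : g \in reachable f ips_succ n -> mass_le (K * n.+1) g.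
  exact: mass_le_reachable degD f_mass DK.
have sum_jump n g : g \in reachable f ips_succ n ->
    \sum_(g' <- ips_succ g) ips_jump src dst V0 m k g g' = 1.
  by move=> /mass_reach/mass_le_F0; exact: sum_ips_jump.
have rate_le n g : g \in reachable f ips_succ n ->
    ips_qtot src dst V0 m k g <= M * K%:R * n.+1%:R.
  by move=> /mass_reach/ips_qtot_le; rewrite natrM mulrA.
have slope_gt0 : 0 < M * K%:R.
  by rewrite mulr_gt0// ltr0n (leq_trans _ DK)// addn2.
have coef_ge0 : 0 <= M * K%:R ^+ p.+1 by rewrite mulr_ge0 ?exprn_ge0// ltW.
apply: (integral_poly_jumps_lty (p := p.+1) law ips_succ_uniq sum_jump
  slope_gt0 rate_le t_ge0 coef_ge0) => [w|w n].
  by apply: ips_normp_at_ge0 => g; exact: ips_normp_ge0.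
move=> /(ips_normp_at_last_jump h (ips_normp m k alpha)) -> /mass_reach hn_mass.
by rewrite lee_fin -mulrA -exprMn -natrM; exact: ips_normp_le.
Qed.

End IPS.

Theorem theorem2p2 (R : realType) (V E : countType) (src dst : E -> V)
  (V0 : set V) (m : V -> R) (k : E -> R)
  (no_loop : forall e, src e <> dst e)
  (simple : forall e e', (src e = src e' /\ dst e = dst e') \/
                         (src e = dst e' /\ dst e = src e') -> e = e')
  (deg_bdd : exists D : nat, forall (x : V) (s : seq E), uniq s ->
               (forall e, e \in s -> src e = x \/ dst e = x) -> (size s <= D)%N)
  (m_pos : forall x, 0 < m x) (k_ge0 : forall e, 0 <= k e)
  (M_fin : exists M : R, (forall x, (m x)^-1 <= M) /\ (forall e, k e <= M))
  (d : measure_display) (Omega : measurableType d) (P : probability Omega R)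
  (f : state V E) (h : nat -> Omega -> state V E) (xi : nat -> Omega -> \bar R)
  (t alpha : R) :
  F0 f -> 0 <= t -> 1 <= alpha ->
  is_IPS src dst V0 m k P f h xi ->
  (\int[P]_w ips_normp_at h xi (ips_normp m k alpha) t w < +oo)%E.
Proof.
move=> /ex_mass_le[K f_mass] t_ge0 alpha_ge1 law.
have [D degD] := deg_bdd; have [M0 [m_inv_le k_le]] := M_fin.
pose M := `|M0| + 1; have M_gt0 : 0 < M by rewrite ltr_wpDl.
have M0_le : M0 <= M by rewrite ler_wpDr// ler_norm.
have alpha_le : 0 < alpha <= (Num.trunc alpha).+1%:R.
  by rewrite (lt_le_trans ltr01)//= ltW// truncnS_gt.
have m_inv_leM x : (m x)^-1 <= M := le_trans (m_inv_le x) M0_le.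
have k_leM e : k e <= M := le_trans (k_le e) M0_le.
have f_massD : mass_le (K + (D + 2)) f.
  by apply: mass_leW f_mass; exact: leq_addr.
exact: (integral_ips_normp_at_lty M_gt0 m_pos k_ge0 m_inv_leM k_leM degD
  (leq_addl K (D + 2)) f_massD law alpha_le t_ge0).
Qed.
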